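(* Let $K$ be a field, $x=(x_1,\dots,x_n)$ an $n$-tuple of variables, and $p,q \in K[x]$. Suppose that $R \ne K$ is a $K$-subalgebra of $K(p/q)$ which is integrally closed in $K(p/q)$, such that either $K$ is algebraically closed, or $R$ contains a nonconstant polynomial. Then there exist $p^{*},q^{*} \in K[x]$ such that $K(p^{*}/q^{*}) = K(p/q)$ and $p^{*}/q^{*} \in R$, where $q^{*} = 1$ (i.e. $q^*$ can be taken equal to $1$) if $R$ contains a nonconstant polynomial.
   Context: All fields are subfields of $K(x)$, the fraction field of $K[x]=K[x_1,\dots,x_n]$. A nonconstant polynomial is an element of $K[x]\setminus K$. Quotients presuppose nonzero denominators. *)

(* Defs.v *)
From HB Require Import structures.
From mathcomp Require Import all_boot all_algebra.
From mathcomp Require Import mpoly.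

Set Implicit Arguments.
Unset Strict Implicit.
Unset Printing Implicit Defensive.

Import GRing.Theory.
Local Open Scope ring_scope.

(* Subsets of K(x) are Prop-valued predicates, so that they range over all
   subfields and subalgebras rather than only the boolean-valued ones. *)

Section RationalFunctions.

Variables (n : nat) (K : fieldType).

Notation Kx := {fraction {mpoly K[n]}}.

Definition ofpoly (p : {mpoly K[n]}) : Kx := FracField.tofrac p.

Definition base_field (z : Kx) : Prop := exists c : K, z = ofpoly c%:MP.

(* Since 0^-1 = 0, closure under inversion needs no side condition. *)
Definition is_subfield (S : Kx -> Prop) : Prop :=
  [/\ S 1, forall y z, S y -> S z -> S (y - z),
      forall y z, S y -> S z -> S (y * z)
    & forall z, S z -> S z^-1].

(* adjoin f is K(f), the smallest subfield of K(x) containing K and f. *)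
Definition adjoin (f z : Kx) : Prop :=
  forall S : Kx -> Prop, is_subfield S ->
    (forall c, base_field c -> S c) -> S f -> S z.

Definition is_subalgebra (R A : Kx -> Prop) : Prop :=
  [/\ forall z, R z -> A z, forall c, base_field c -> R c,
      forall y z, R y -> R z -> R (y - z)
    & forall y z, R y -> R z -> R (y * z)].

(* The library's integralOver expects a ring type for the coefficients;
   here they are taken in a subset. *)
Definition integral_over (R : Kx -> Prop) (z : Kx) : Prop :=
  exists P : {poly Kx}, [/\ P \is monic, forall i, R P`_i & root P z].

Definition integrally_closed_in (R A : Kx -> Prop) : Prop :=
  forall z, A z -> integral_over R z -> R z.

Definition contains_nonconstant_poly (R : Kx -> Prop) : Prop :=
  exists g : {mpoly K[n]}, (forall c : K, g <> c%:MP) /\ R (ofpoly g).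

End RationalFunctions.

(* Main.v *)
(* Write [f = p / q], pick [g] in [R] outside [K] (a polynomial if possible), and
   write [g = U(f) / V(f)] with [U] and [V] coprime.  If [deg U > deg V], then [f]
   is integral over [K[g]].  Otherwise [V] has a root [c] in [K]: this is clear
   when [K] is algebraically closed, and when [g] is a polynomial [c] is the value
   of [f] at a place where [g] is infinite.  Then [1 / (f - c)] is integral over
   [K[g]], because its only pole is a pole of [g].  In both cases the generator
   found is in [R], and it is integral over [K[x]], hence a polynomial, when [g]
   is a polynomial. *)
From HB Require Import structures.
Require Import Defs.
From Stdlib Require Import Classical.
From mathcomp Require Import all_boot all_order all_algebra.
From mathcomp Require Import mpoly.
Import Order.TTheory GRing.Theory.
Local Open Scope ring_scope.

Set Implicit Arguments.
Unset Strict Implicit.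
Unset Printing Implicit Defensive.

HB.instance Definition _ (n : nat) (K : fieldType) :=
  GRing.RMorphism.copy (@ofpoly n K) (@FracField.tofrac {mpoly K[n]}).

Lemma ofpoly_inj (n : nat) (K : fieldType) : injective (@ofpoly n K).
Proof. by move=> p q /eqP; rewrite /ofpoly tofrac_eq => /eqP. Qed.

Lemma ofpoly_eq0 (n : nat) (K : fieldType) (p : {mpoly K[n]}) :
  (ofpoly p == 0) = (p == 0).
Proof. by rewrite /ofpoly tofrac_eq0. Qed.

Definition cst (n : nat) (K : fieldType) : K -> {fraction {mpoly K[n]}} :=
  @ofpoly n K \o @mpolyC n K.

HB.instance Definition _ (n : nat) (K : fieldType) :=
  GRing.RMorphism.copy (@cst n K) (@ofpoly n K \o @mpolyC n K).

(** * Integral closedness of [K[x]] *)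

(** Leading monomials are additive, so an excess of [u] over [v] in variable [i] grows linearly with
    [m], while [s] can make up for at most [mlead s i] of it. *)
Lemma lem_mlead_of_dvd_powers (n : nat) (K : fieldType) (u v s : {mpoly K[n]}) :
    u != 0 -> v != 0 -> s != 0 ->
    (forall m, exists w, s * v ^+ m = w * u ^+ m) ->
  (mlead u <= mlead v)%MM.
Proof.
move=> u0 v0 s0 dvd; apply/mnm_lepP => i.
have [w Ew] := dvd (mlead s i).+1.
have w0 : w != 0.
  apply: contraTneq (mulf_neq0 s0 (expf_neq0 (mlead s i).+1 v0)) => w0.
  by rewrite Ew w0 mul0r eqxx.
move: (congr1 (fun x => mlead x i) Ew).
rewrite !mleadM ?expf_neq0 // !mleadX // !mnmDE !mulmnE => E.
rewrite leqNgt; apply/negP => lt_vu.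
suff : (mlead s i + mlead v i * (mlead s i).+1 <
        mlead w i + mlead u i * (mlead s i).+1)%N by rewrite E ltnn.
apply: leq_trans (leq_trans (leq_mul lt_vu (leqnn _)) (leq_addl _ _)).
by rewrite mulSn -addSn leq_add2r.
Qed.

(* [K[x]] is completely integrally closed: since [v / u] is almost integral, so
   is [v / u - t] for every polynomial [t], and [t] can be chosen to lower the
   leading monomial of the numerator. *)
Lemma mpoly_dvd_of_dvd_powers (n : nat) (K : fieldType)
    (u v s : {mpoly K[n]}) :
    u != 0 -> s != 0 -> (forall m, exists w, s * v ^+ m = w * u ^+ m) ->
  exists w, v = w * u.
Proof.
move=> u0 s0; elim/mleadrect: v => v IH dvd.
have [->|v0] := eqVneq v 0; first by exists 0; rewrite mul0r.
have le_uv := lem_mlead_of_dvd_powers u0 v0 s0 dvd.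
(* The quotient of the leading terms of [v] and [u], so that [v - t * u] loses the leading term of
   [v]. *)
pose t : {mpoly K[n]} :=
  (v@_(mlead v) / u@_(mlead u)) *: 'X_[mlead v - mlead u].
have c0 : v@_(mlead v) / u@_(mlead u) != 0.
  by rewrite mulf_neq0 ?invr_eq0 ?mleadc_eq0.
have lt_t : mlead t = (mlead v - mlead u)%MM.
  by rewrite mleadZ // mleadXm.
have t0 : t != 0.
  by rewrite scaler_eq0 negb_or c0 -mleadc_eq0 mleadXm mcoeffX eqxx oner_eq0.
have lt_tu : mlead (t * u) = mlead v by rewrite mleadM // lt_t submK.
have lc_tu : (t * u)@_(mlead v) = v@_(mlead v).
  rewrite -{1}lt_tu mleadM // mleadcM lt_t mcoeffZ mcoeffX eqxx mulr1.
  by rewrite divfK ?mleadc_eq0.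
pose v' := v - t * u.
have [v'0|v'0] := eqVneq v' 0.
  by exists t; apply/eqP; rewrite -subr_eq0 -/v' v'0.
have lt_v' : (mlead v' < mlead v)%O.
  rewrite lt_neqAle; apply/andP; split; last first.
    by apply: le_trans (mleadB_le _ _) _; rewrite lt_tu joinxx.
  by apply: contra v'0 => /eqP E; rewrite -mleadc_eq0 E mcoeffB lc_tu subrr.
have [|w Ew] := IH v' lt_v'.
  (* In the binomial expansion of [s * (v - t * u) ^+ m], each term contains some
     [s * v ^+ (m - i) * u ^+ i], hence is a multiple of [u ^+ m]. *)
  move=> m; rewrite exprBn mulr_sumr.
  apply: (big_rec (fun x => exists w, x = w * u ^+ m)).
    by exists 0; rewrite mul0r.
  move=> i x _ [w ->]; have [w1 Ew1] := dvd (m - i)%N.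
  have le_im : (i <= m)%N by rewrite -ltnS.
  exists (((-1) ^+ i * w1 * t ^+ i) *+ 'C(m, i) + w).
  rewrite mulrDl; congr (_ + _).
  rewrite mulrnAr mulrnAl; congr (_ *+ _).
  have -> : u ^+ m = u ^+ (m - i) * u ^+ i by rewrite -exprD subnK.
  rewrite exprMn.
  transitivity ((-1) ^+ i * (s * v ^+ (m - i)) * t ^+ i * u ^+ i).
    by rewrite !mulrA [s * _]mulrC.
  rewrite Ew1 !mulrA; congr (_ * _); rewrite -!mulrA; do 2!congr (_ * _).
  exact: mulrC.
by exists (w + t); rewrite mulrDl -Ew subrK.
Qed.

(* Modulo a monic equation of degree [N] for [v / u], every power of [v / u]
   becomes a combination of the first [N], so [u ^+ N] clears all denominators. *)
Lemma integral_over_mpoly (n : nat) (K : fieldType) (u v : {mpoly K[n]}) :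
    u != 0 ->
    integral_over (fun z => exists w, z = ofpoly w) (ofpoly v / ofpoly u) ->
  exists w, ofpoly v / ofpoly u = ofpoly w.
Proof.
move=> u0 [P [monP polyP Py0]]; set y := _ / _ in Py0 *.
have uy0 : ofpoly u != 0 by rewrite ofpoly_eq0.
have [c Ec] := fin_all_exists (fun i : 'I_(size P) => polyP i).
(* [P] is lifted to [K[x]], so that division by this monic polynomial leaves remainders with
   coefficients in [K[x]]. *)
pose P' : {poly {mpoly K[n]}} := \sum_i (c i)%:P * 'X^i.
have EP : map_poly (@ofpoly n K) P' = P.
  rewrite rmorph_sum -[RHS]coefK poly_def; apply: eq_bigr => i _.
  by rewrite rmorphM /= map_polyC map_polyXn /= -Ec mul_polyC.
have monP' : P' \is monic.
  apply/eqP; apply: (@ofpoly_inj n K).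
  rewrite -lead_coef_map_inj ?rmorph0 //; last exact: ofpoly_inj.
  by rewrite EP (monicP monP) (rmorph1 (@ofpoly n K)).
have [||w Ew] := @mpoly_dvd_of_dvd_powers n K u v (u ^+ size P') u0.
- by rewrite expf_neq0.
- move=> m; pose r := Pdiv.CommonRing.rmodp ('X^m) P'.
  have lt_r : (size r < size P')%N.
    by rewrite Pdiv.CommonRing.ltn_rmodpN0 ?monic_neq0.
  have Er : y ^+ m = (map_poly (@ofpoly n K) r).[y].
    have := congr1 (fun Q => (map_poly (@ofpoly n K) Q).[y])
      (Pdiv.RingMonic.rdivp_eq monP' 'X^m).
    rewrite rmorphD rmorphM /= hornerD hornerM EP (rootP Py0) ?mulr0 ?add0r.
    by rewrite map_polyXn hornerXn.
  exists (\sum_(i < size P') r`_i * v ^+ i * u ^+ (size P' - i)).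
  apply: (@ofpoly_inj n K).
  rewrite !rmorphM !rmorphXn /= rmorph_sum /= mulr_suml.
  have Ev : ofpoly v = y * ofpoly u by rewrite divfK.
  rewrite {1}Ev exprMn Er (horner_coef_wide _ (n := size P')); last first.
    by apply: leq_trans (size_poly _ _) (ltnW lt_r).
  rewrite mulrA mulr_sumr mulr_suml; apply: eq_bigr => i _.
  have -> : ofpoly u ^+ size P' = ofpoly u ^+ (size P' - i) * ofpoly u ^+ i.
    by rewrite -exprD subnK // ltnW.
  rewrite coef_map !rmorphM !rmorphXn /= Ev [in RHS]exprMn.
  congr (_ * _); rewrite mulrCA -[RHS]mulrA; congr (_ * _).
  rewrite [LHS]mulrC -[RHS]mulrA; congr (_ * _).
  exact: mulrC.
by exists w; rewrite /y Ew rmorphM /= mulfK.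
Qed.

Lemma cst_eq0 (n : nat) (K : fieldType) (c : K) : (cst n c == 0) = (c == 0).
Proof. exact: (fmorph_eq0 (@cst n K)). Qed.

Lemma base_field_cst (n : nat) (K : fieldType) (c : K) : base_field (cst n c).
Proof. by exists c. Qed.

Lemma is_subalgebra_mpoly (n : nat) (K : fieldType) :
  is_subalgebra (fun z : {fraction {mpoly K[n]}} => exists w, z = ofpoly w)
    (fun=> True).
Proof.
split=> // [_ [c ->]|_ _ [v ->] [w ->]|_ _ [v ->] [w ->]].
- by exists c%:MP.
- by exists (v - w); rewrite rmorphB.
- by exists (v * w); rewrite rmorphM.
Qed.

(** * Integral equations obtained from [U(f) = g V(f)] *)

Section Integrality.

Variables (n : nat) (K : fieldType) (S A : {fraction {mpoly K[n]}} -> Prop).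
Hypothesis subS : is_subalgebra S A.

Notation Kx := {fraction {mpoly K[n]}}.
Notation "P ^K" := (map_poly (@cst n K) P) (at level 2, format "P ^K").

Lemma subalgebra_coef (U V : {poly K}) (g : Kx) :
  S g -> forall i, S (U^K - g *: V^K)`_i.
Proof.
case: subS => _ Sc SB SM Sg i; rewrite coefB coefZ !coef_map.
by apply: SB; last apply: SM => //; apply: Sc; apply: base_field_cst.
Qed.

Lemma integral_of_lead_coef (Q : {poly Kx}) (a : K) (y : Kx) :
    a != 0 -> lead_coef Q = cst n a -> (forall i, S Q`_i) -> root Q y ->
  integral_over S y.
Proof.
case: subS => _ Sc SB SM a0 Qa SQ Qy; exists ((cst n a)^-1 *: Q); split.
- rewrite monicE lead_coefZ Qa mulVf ?eqxx //.
  by rewrite cst_eq0.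
- move=> i; rewrite coefZ -fmorphV; apply: SM => //.
  exact/Sc/base_field_cst.
- by rewrite rootE hornerZ (rootP Qy) mulr0 eqxx.
Qed.

(** Reversing the coefficients of [Q] gives a polynomial that vanishes at [y^-1] and has the
    constant [a] as leading coefficient. *)
Lemma integral_inv (Q : {poly Kx}) (a : K) (y : Kx) :
    y != 0 -> a != 0 -> Q`_0 = cst n a -> (forall i, S Q`_i) -> root Q y ->
  integral_over S y^-1.
Proof.
move=> y0 a0 Qa SQ Qy.
have sQ : (0 < size Q)%N.
  by rewrite lt0n size_poly_eq0; apply: contraNneq a0 => Q0;
    rewrite -(cst_eq0 n) -Qa Q0 coef0 eqxx.
pose T := \poly_(i < size Q) Q`_(size Q - i.+1).
have T0 : T`_(size Q).-1 = cst n a.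
  by rewrite coef_poly prednK // leqnn subnn.
have sT : size T = size Q.
  apply/eqP; rewrite eqn_leq size_poly /= -(prednK sQ) ltnNge; apply/negP => le.
  by move: (T0); rewrite nth_default // => /esym/eqP; rewrite cst_eq0 (negPf a0).
apply: (integral_of_lead_coef (Q := T) a0).
- by rewrite lead_coefE sT.
- move=> i; rewrite coef_poly; case: ifP => // _.
  by case: subS => _ Sc _ _; rewrite -(rmorph0 (@cst n K)); exact/Sc/base_field_cst.
- have : y^-1 ^+ (size Q).-1 * Q.[y] == 0 by rewrite (rootP Qy) mulr0 eqxx.
  congr (_ == 0); rewrite horner_coef horner_poly mulr_sumr.
  rewrite (reindex_inj rev_ord_inj); apply: eq_bigr => i _ /=.
  rewrite mulrCA; congr (_ * _).
  have -> : (size Q).-1 = (size Q - i.+1 + i)%N.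
    by rewrite -[in LHS](subnK (ltn_ord i)) addnS.
  by rewrite exprD exprVn [y^-1 ^+ i]exprVn mulrAC mulVf ?mul1r ?expf_neq0.
Qed.

Variables (U V : {poly K}) (g f : Kx).
Hypotheses (Sg : S g) (Ef : U^K.[f] = g * V^K.[f]).

(** [f] is a root of [U - g V], whose leading coefficient is that of [U] because [g V] has smaller
    degree. *)
Lemma integral_of_pole_at_infinity :
  (size V < size U)%N -> integral_over S f.
Proof.
move=> ltVU; apply: (@integral_of_lead_coef (U^K - g *: V^K) (lead_coef U)).
- by rewrite lead_coef_eq0 -size_poly_gt0 (leq_ltn_trans _ ltVU).
- rewrite lead_coefDl ?lead_coef_map // size_polyN.
  by rewrite (leq_ltn_trans (size_scale_leq _ _)) // !size_map_poly.
- exact: subalgebra_coef.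
- by rewrite rootE hornerD hornerN hornerZ Ef subrr eqxx.
Qed.

(** After translation by [c], the constant coefficient of [U - g V] is [U(c) - g V(c) = U(c)], a
    nonzero element of [K]. *)
Lemma integral_of_pole (c : K) :
    root V c -> ~~ root U c -> f - cst n c != 0 ->
  integral_over S (f - cst n c)^-1.
Proof.
move=> Vc Uc fc; pose U1 := U \Po ('X + c%:P); pose V1 := V \Po ('X + c%:P).
have shift (W : {poly K}) : (W \Po ('X + c%:P))^K.[f - cst n c] = W^K.[f].
  rewrite map_comp_poly horner_comp rmorphD /= map_polyX map_polyC /=.
  by rewrite hornerD hornerX hornerC subrK.
have shift0 (W : {poly K}) : (W \Po ('X + c%:P))`_0 = W.[c].
  by rewrite -horner_coef0 horner_comp hornerD hornerX hornerC add0r.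
apply: (integral_inv (Q := U1^K - g *: V1^K) fc Uc).
- by rewrite coefB coefZ !coef_map /= !shift0 (rootP Vc) rmorph0 mulr0 subr0.
- exact: subalgebra_coef.
- by rewrite rootE hornerD hornerN hornerZ !shift Ef subrr eqxx.
Qed.

End Integrality.

(** * Roots of the denominator through leading monomials *)

Lemma exprM_div (F : fieldType) (a b : F) (i d : nat) :
  b != 0 -> (i <= d)%N -> b ^+ d * (a / b) ^+ i = a ^+ i * b ^+ (d - i).
Proof.
move=> b0 le_id; rewrite -{1}(subnK le_id) exprD expr_div_n mulrC -mulrA.
by congr (_ * _); rewrite mulrCA mulVf ?mulr1 ?expf_neq0.
Qed.

(** The bound [e] need not be attained: [p] and [q] will share one [e], at which one of them may
    have coefficient 0. *)
Lemma mlead_mcoeffX (n : nat) (K : fieldType) (e : 'X_{1..n})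
    (p : {mpoly K[n]}) (k : nat) :
    (mlead p <= e)%O ->
  (mlead (p ^+ k) <= (e *+ k)%MM)%O /\ (p ^+ k)@_(e *+ k) = p@_e ^+ k.
Proof.
move=> le_pe; elim: k => [|k [IHle IHc]].
  by rewrite mulm0n !expr0 mlead1 mcoeff1 eqxx.
rewrite mulmS !exprS mleadcMW // IHc; split=> //.
exact: le_trans (mleadM_le _ _) (lem_add le_pe IHle).
Qed.

(** When [deg U <= d], this is the numerator of [U(p / q)] over [q ^+ d], kept as a polynomial so
    that it has a leading monomial. *)
Definition homogenization (n : nat) (K : fieldType) (p q : {mpoly K[n]})
    (d : nat) (U : {poly K}) : {mpoly K[n]} :=
  \sum_(i < d.+1) U`_i *: (p ^+ i * q ^+ (d - i)).

Lemma mlead_mcoeff_homogenization (n : nat) (K : fieldType) (e : 'X_{1..n})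
    (p q : {mpoly K[n]}) (d : nat) (U : {poly K}) :
    (mlead p <= e)%O -> (mlead q <= e)%O ->
  (mlead (homogenization p q d U) <= (e *+ d)%MM)%O /\
  (homogenization p q d U)@_(e *+ d) =
    \sum_(i < d.+1) U`_i * (p@_e ^+ i * q@_e ^+ (d - i)).
Proof.
move=> le_pe le_qe.
have term (i : 'I_d.+1) :
    (mlead (p ^+ i * q ^+ (d - i)) <= (e *+ d)%MM)%O /\
    (p ^+ i * q ^+ (d - i))@_(e *+ d) = p@_e ^+ i * q@_e ^+ (d - i).
  have [le_pie <-] := mlead_mcoeffX i le_pe.
  have [le_qie <-] := mlead_mcoeffX (d - i) le_qe.
  have -> : (e *+ d)%MM = (e *+ i + e *+ (d - i))%MM.
    by apply/mnmP => j; rewrite mnmDE !mulmnE -mulnDr subnKC // -ltnS.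
  rewrite mleadcMW //; split=> //.
  exact: le_trans (mleadM_le _ _) (lem_add le_pie le_qie).
split.
  apply: (big_ind (fun x => (mlead x <= (e *+ d)%MM)%O)) => [|x y lex ley|i _].
  - by rewrite mlead0 le0x.
  - by apply: le_trans (mleadD_le _ _) _; rewrite leUx lex.
  - exact: le_trans (mleadZ_le _ _) (term i).1.
by rewrite raddf_sum; apply: eq_bigr => i _ /=; rewrite mcoeffZ (term i).2.
Qed.

Lemma ofpoly_homogenization (n : nat) (K : fieldType) (p q : {mpoly K[n]})
    (d : nat) (U : {poly K}) :
    q != 0 -> (size U <= d.+1)%N ->
  ofpoly (homogenization p q d U) =
    ofpoly q ^+ d * (map_poly (@cst n K) U).[ofpoly p / ofpoly q].
Proof.
move=> q0 sU; have q0' : ofpoly q != 0 by rewrite ofpoly_eq0.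
rewrite (horner_coef_wide _ (n := d.+1)) ?size_map_poly //.
rewrite rmorph_sum mulr_sumr; apply: eq_bigr => i _ /=.
have le_id : (i <= d)%N by rewrite -ltnS.
rewrite -mul_mpolyC !rmorphM !rmorphXn /= coef_map [RHS]mulrCA.
by rewrite exprM_div.
Qed.

(* Leading monomials give a place of [K(x)] at which the polynomial [g] is
   infinite.  Since [U / V] is finite at infinity, [p / q] must take a finite
   value [c] there, and [V] vanishes at [c]. *)
Lemma root_of_denominator (n : nat) (K : fieldType) (p q g : {mpoly K[n]})
    (U V : {poly K}) :
    q != 0 -> mlead g != 0%MM -> V != 0 -> (size U <= size V)%N ->
    (map_poly (@cst n K) U).[ofpoly p / ofpoly q] =
      ofpoly g * (map_poly (@cst n K) V).[ofpoly p / ofpoly q] ->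
  exists c, root V c.
Proof.
move=> q0 g0 V0 sUV E; pose d := (size V).-1; pose e := (mlead p `|` mlead q)%O.
have le_pe : (mlead p <= e)%O by rewrite leUl.
have le_qe : (mlead q <= e)%O by rewrite leUr.
have sV : size V = d.+1 by rewrite prednK // size_poly_gt0.
have Eh : homogenization p q d U = g * homogenization p q d V.
  apply: (@ofpoly_inj n K); rewrite rmorphM /=.
  by rewrite !ofpoly_homogenization // -?sV // E mulrCA.
have [leU _] := mlead_mcoeff_homogenization d U le_pe le_qe.
have [leV EV] := mlead_mcoeff_homogenization d V le_pe le_qe.
have g_neq0 : g != 0 by apply: contraNneq g0 => ->; rewrite mlead0.
(* Times the leading coefficient of [g], this is the coefficient of [homogenization p q d U] at
   [mlead g + e *+ d], a monomial beyond the bound [e *+ d]. *)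
have : (homogenization p q d V)@_(e *+ d) = 0.
  apply/eqP; rewrite -(mulrI_eq0 _ (x := g@_(mlead g))).
    rewrite -mleadcMW // -Eh mcoeff_gt_mlead //.
    apply: le_lt_trans leU _; rewrite -{1}[(e *+ d)%MM]add0m.
    by rewrite ltmc_add2l lt_neqAle eq_sym g0 le0x.
  by apply/lregP; rewrite mleadc_eq0.
rewrite EV; have [be0|be0] := eqVneq q@_e 0; last first.
  (* The ratio of the coefficients at [e] is the value of [p / q] at the place. *)
  move=> sum0; exists (p@_e / q@_e); apply/rootP.
  apply: (mulfI (expf_neq0 d be0)); rewrite mulr0 -[RHS]sum0.
  rewrite horner_coef sV mulr_sumr; apply: eq_bigr => i _.
  have le_id : (i <= d)%N by rewrite -ltnS.
  by rewrite mulrCA exprM_div.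
(* Only the term in [p ^+ d] survives, so [p@_e = 0] too, although [e] is the leading monomial of
   [p] or of [q]. *)
rewrite be0 big_ord_recr big1 /= => [|i _]; last first.
  by rewrite expr0n subn_eq0 leqNgt ltn_ord !mulr0.
rewrite add0r subnn expr0 mulr1 => /eqP.
rewrite mulf_eq0 -lead_coefE lead_coef_eq0 (negPf V0) /= expf_eq0.
case/andP=> _ /eqP al0.
have [Ee|Ee] : e = mlead p \/ e = mlead q.
  by rewrite /e; case: (leP (mlead p) (mlead q)) => h; [right|left].
(* For [p = 0] the convention [mlead 0 = 0] makes [e] the least monomial, so [mlead q] equals [e] as
   well. *)
- have p0 : p = 0 by apply/eqP; rewrite -mleadc_eq0 -Ee al0.
  move: be0; rewrite Ee p0 mlead0.
  have -> : 0%MM = mlead q.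
    by apply/eqP; rewrite eq_le le0m -[X in (_ <= X)%O](mlead0 n K) -p0 -Ee.
  by move/eqP; rewrite mleadc_eq0 (negPf q0).
- by move/eqP: be0; rewrite Ee mleadc_eq0 (negPf q0).
Qed.

(** * The field [K(f)] *)

Section Adjoin.

Variables (n : nat) (K : fieldType).
Notation Kx := {fraction {mpoly K[n]}}.
Implicit Types f z : Kx.

Lemma adjoin_subfield f : is_subfield (adjoin f).
Proof.
split=> [S sf|y z Ay Az S sf cS fS|y z Ay Az S sf cS fS|z Az S sf cS fS];
  case: (sf) => S1 SB SM SV //.
- by apply: SB; [apply: Ay|apply: Az].
- by apply: SM; [apply: Ay|apply: Az].
- by apply: SV; apply: Az.
Qed.

Lemma adjoin_cst f (c : K) : adjoin f (cst n c).
Proof. by move=> S _ cS _; apply/cS/base_field_cst. Qed.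

Lemma adjoin_gen f : adjoin f f.
Proof. by []. Qed.

Lemma adjoin_trans f h z : adjoin f h -> adjoin h z -> adjoin f z.
Proof.
move=> fh hz; apply: hz => //; first exact: adjoin_subfield.
by move=> _ [c ->]; exact: adjoin_cst.
Qed.

Lemma adjoin_moebius f (c : K) z :
  adjoin (f - cst n c)^-1 z <-> adjoin f z.
Proof.
have [_ fB _ fV] := adjoin_subfield f.
have [_ hB _ hV] := adjoin_subfield (f - cst n c)^-1.
split; apply: adjoin_trans.
  exact: fV _ (fB _ _ (@adjoin_gen f) (@adjoin_cst f c)).
have E : f = (f - cst n c)^-1^-1 - cst n (- c).
  by rewrite invrK rmorphN opprK subrK.
have := hB _ _ (hV _ (@adjoin_gen (f - cst n c)^-1)) (@adjoin_cst _ (- c)).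
by rewrite -E.
Qed.

(** The values [U(f) / V(f)] with [V(f)] nonzero form a subfield containing [K] and [f]; the gcd of
    [U] and [V] can be divided out because it does not vanish at [f] either. *)
Lemma adjoin_coprime_ratio f z : adjoin f z ->
  exists U V : {poly K}, [/\ coprimep U V, (map_poly (@cst n K) V).[f] != 0
    & (map_poly (@cst n K) U).[f] = z * (map_poly (@cst n K) V).[f]].
Proof.
pose ev (W : {poly K}) := (map_poly (@cst n K) W).[f].
have evM V W : ev (V * W) = ev V * ev W by rewrite /ev rmorphM hornerM.
have evB V W : ev (V - W) = ev V - ev W.
  by rewrite /ev rmorphB hornerD hornerN.
have ev1 : ev 1 = 1 by rewrite /ev rmorph1 hornerC.
move=> fz; suff [U [V [Vf EU]]] : exists U V, ev V != 0 /\ ev U = z * ev V.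
  have V0 : V != 0.
    by apply: contraNneq Vf => ->; rewrite /ev rmorph0 horner0 eqxx.
  have EU' : ev (U %/ gcdp U V) * ev (gcdp U V) = ev U.
    by rewrite -evM divpK ?dvdp_gcdl.
  have EV' : ev (V %/ gcdp U V) * ev (gcdp U V) = ev V.
    by rewrite -evM divpK ?dvdp_gcdr.
  have G0 : ev (gcdp U V) != 0.
    by apply: contraNneq Vf => G0; rewrite -EV' G0 mulr0 eqxx.
  exists (U %/ gcdp U V), (V %/ gcdp U V); split.
  - by rewrite coprimep_div_gcd // V0 orbT.
  - by apply: contraNneq Vf => V'0; rewrite -EV' (V'0 : ev _ = 0) mul0r eqxx.
  - by apply: (mulIf G0); rewrite -mulrA -/(ev _) -/(ev (V %/ _)) EV' EU' EU.
apply: (fz (fun y => exists U V, ev V != 0 /\ ev U = y * ev V)).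
- split.
  + by exists 1, 1; rewrite ev1 mulr1 oner_neq0.
  + move=> y1 y2 [U1 [V1 [V10 E1]]] [U2 [V2 [V20 E2]]].
    exists (U1 * V2 - U2 * V1), (V1 * V2); split.
      by rewrite evM; exact: mulf_neq0 V10 V20.
    rewrite evB !evM E1 E2 mulrBl -!mulrA.
    by rewrite [ev V2 * ev V1]mulrC.
  + move=> y1 y2 [U1 [V1 [V10 E1]]] [U2 [V2 [V20 E2]]].
    exists (U1 * U2), (V1 * V2); split.
      by rewrite evM; exact: mulf_neq0 V10 V20.
    by rewrite !evM E1 E2 mulrACA.
  + move=> y [U1 [V1 [V10 E1]]].
    (* Since [0^-1 = 0], the inverse of zero is given by the fraction [0 / 1] and not by
       swapping. *)
    have [->|y0] := eqVneq y 0.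
      by exists 0, 1; rewrite ev1 oner_neq0 invr0 mul0r /ev rmorph0 horner0.
    exists V1, U1; split; first by rewrite E1; exact: mulf_neq0 y0 V10.
    by rewrite E1 mulKf.
- move=> _ [c ->]; exists c%:P, 1; rewrite ev1 oner_neq0 mulr1.
  by rewrite /ev map_polyC hornerC.
- by exists 'X, 1; rewrite ev1 oner_neq0 mulr1 /ev map_polyX hornerX.
Qed.

End Adjoin.

(** * Construction of the new generator *)

Lemma mlead_neq0 (n : nat) (K : fieldType) (g : {mpoly K[n]}) :
  (forall c : K, g <> c%:MP) -> mlead g != 0%MM.
Proof.
move=> gK; have g0 : g != 0 by apply/eqP => g0; apply: (gK 0); rewrite g0 rmorph0.
apply/eqP => lg; apply: (gK g@_0); apply: msize1_polyC.
by rewrite -mlead_deg // lg mdeg0.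
Qed.

Theorem corollary3p6 (n : nat) (K : fieldType) (p q : {mpoly K[n]})
    (hq : q != 0)
    (R : {fraction {mpoly K[n]}} -> Prop)
    (hRK : ~ (forall z, R z <-> base_field z))
    (hRsub : is_subalgebra R (adjoin (ofpoly p / ofpoly q)))
    (hRint : integrally_closed_in R (adjoin (ofpoly p / ofpoly q)))
    (hK : GRing.closed_field_axiom K \/ contains_nonconstant_poly R) :
  exists ps qs : {mpoly K[n]},
    [/\ qs != 0,
        forall z, adjoin (ofpoly ps / ofpoly qs) z
                  <-> adjoin (ofpoly p / ofpoly q) z,
        R (ofpoly ps / ofpoly qs)
      & contains_nonconstant_poly R -> qs = 1].
Proof.
set f := ofpoly p / ofpoly q in hRsub hRint *.
have [RA RK _ _] := hRsub.
have [g [Rg gK g_poly]] : exists g, [/\ R g, ~ base_field g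
    & contains_nonconstant_poly R ->
      exists2 g0 : {mpoly K[n]}, g = ofpoly g0 & mlead g0 != 0%MM].
  have [[g0 [g0K Rg0]]|noR] := classic (contains_nonconstant_poly R).
    exists (ofpoly g0); split=> // [[c /ofpoly_inj]|_]; first exact: g0K.
    by exists g0; last exact: mlead_neq0.
  (* If no element of [R] lay outside [K], then [R] would be [K]. *)
  apply: NNPP => none; apply: hRK => z; split=> [Rz|]; last exact: RK.
  by apply: NNPP => zK; apply: none; exists z; split.
have [U [V [copUV Vf Ef]]] := adjoin_coprime_ratio (RA _ Rg).
(* A generator of [K(f)] integral over [K[g]] lies in [R], and is a polynomial
   as soon as [g] is one. *)
have finish (P Q : {mpoly K[n]}) : Q != 0 ->
    (forall z, adjoin (ofpoly P / ofpoly Q) z <-> adjoin f z) ->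
    (forall S A, is_subalgebra S A -> S g ->
       integral_over S (ofpoly P / ofpoly Q)) ->
  exists ps qs : {mpoly K[n]},
    [/\ qs != 0, forall z, adjoin (ofpoly ps / ofpoly qs) z <-> adjoin f z,
        R (ofpoly ps / ofpoly qs) & contains_nonconstant_poly R -> qs = 1].
  move=> Q0 adjE intS.
  have Rh : R (ofpoly P / ofpoly Q).
    exact: hRint _ ((adjE _).1 (@adjoin_gen _ _ _)) (intS _ _ hRsub Rg).
  have [cR|noR] := classic (contains_nonconstant_poly R); last by exists P, Q.
  have [g0 Eg _] := g_poly cR.
  (* The integral equation holds over every algebra containing [g], so it is used again with [K[x]]
     in place of [R]. *)
  have [|w Ew] := integral_over_mpoly (v := P) Q0.
    by apply: intS (is_subalgebra_mpoly n K) _; exists g0.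
  have w1 : ofpoly w / ofpoly 1 = ofpoly P / ofpoly Q.
    by rewrite Ew (rmorph1 (@ofpoly n K)) divr1.
  by exists w, 1; rewrite w1 oner_neq0.
have [ltVU|leUV] := ltnP (size V) (size U).
  apply: (finish p q) => // S A subS Sg.
  exact (integral_of_pole_at_infinity subS Sg Ef ltVU).
have V0 : V != 0.
  by apply: contraNneq Vf => ->; rewrite rmorph0 horner0 eqxx.
have [c Vc] : exists c, root V c.
  case: hK => [closedK|cR]; last first.
    have [g0 Eg g00] := g_poly cR.
    by rewrite Eg in Ef; exact (root_of_denominator hq g00 V0 leUV Ef).
  (* Without a root [V] is constant, and by [leUV] so is [U]; then [g] would lie in [K]. *)
  apply/(PreClosedField.closed_rootP closedK)/negP => /size_poly1P[b b0 EV].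
  move: leUV; rewrite EV size_polyC b0 => /size1_polyC EU.
  apply: gK; exists (U`_0 / b).
  have evC a : (map_poly (@cst n K) a%:P).[f] = cst n a.
    by rewrite map_polyC hornerC.
  rewrite EV EU !evC in Ef.
  have b0' : cst n b != 0 by rewrite cst_eq0.
  by apply: (mulIf b0'); rewrite -Ef -[ofpoly _]/(cst n _) -(rmorphM (@cst n K)) divfK.
have Uc : ~~ root U c.
  apply: contraTN copUV => Uc.
  apply/negP => cop; have := coprimep_root cop Uc.
  by rewrite (rootP Vc) eqxx.
(* [V] vanishes at [c] but not at [f]. *)
have fc : f - cst n c != 0.
  apply: contraNneq Vf => /eqP; rewrite subr_eq0 => /eqP ->.
  by rewrite horner_map (rootP Vc) rmorph0 eqxx.
have q0' : ofpoly q != 0 by rewrite ofpoly_eq0.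
have Ec : f - cst n c = ofpoly (p - c%:MP * q) / ofpoly q.
  by rewrite rmorphB rmorphM /= mulrBl mulfK.
have Eh : ofpoly q / ofpoly (p - c%:MP * q) = (f - cst n c)^-1.
  by rewrite Ec invf_div.
apply: (finish q (p - c%:MP * q)); rewrite ?Eh.
- by apply: contraNneq fc => pq0; rewrite Ec pq0 rmorph0 mul0r eqxx.
- exact: adjoin_moebius.
- by move=> S A subS Sg; exact (integral_of_pole subS Sg Ef Vc Uc fc).
Qed.
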